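(* For every integer $k\geq 6$, $\operatorname{GM}_{k}(K_{3}:2K_{2})=3$.
   Context: All graphs are finite, simple and undirected; colorings are edge-colorings. $2K_2$ is a matching with $2$ edges. A $k$-coloring is exact if all $k$ colors are used at least once. A colored graph is rainbow if no two of its edges have the same color, and monochromatic if all its edges have the same color. Copies of a graph are counted as (not necessarily induced) subgraphs. The Gallai-Ramsey number $\operatorname{gr}_k(G:H)$ is the minimum integer $m$ with $\binom{m}{2}\geq k$ such that for every $N\geq m$, every exact $k$-coloring of $K_N$ contains a rainbow copy of $G$ or a monochromatic copy of $H$. The Gallai-Ramsey multiplicity $\operatorname{GM}_k(G:H)$ (also written $\operatorname{GM}_k(G,H)$) is the minimum, over all exact $k$-colorings of $K_{\operatorname{gr}_k(G:H)}$, of the total number of rainbow copies of $G$ and monochromatic copies of $H$. *)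

(* Defs.v *)
From mathcomp Require Import all_boot.

Set Implicit Arguments.
Unset Strict Implicit.
Unset Printing Implicit Defensive.

Record sgraph := SGraph {
  vertex : finType;
  edges : {set {set vertex}};
  edges_card2 : forall e, e \in edges -> #|e| = 2
}.

Definition complete_edges (n : nat) : {set {set 'I_n}} :=
  [set e : {set 'I_n} | #|e| == 2].

Lemma complete_edges_card2 (n : nat) (e : {set 'I_n}) :
  e \in complete_edges n -> #|e| = 2.
Proof. by rewrite inE => /eqP. Qed.

Definition complete (n : nat) : sgraph := SGraph (@complete_edges_card2 n).

Definition matching_edges (t : nat) : {set {set 'I_t * bool}} :=
  [set [set (i, false); (i, true)] | i : 'I_t].

Lemma matching_edges_card2 (t : nat) (e : {set 'I_t * bool}) :
  e \in matching_edges t -> #|e| = 2.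
Proof. by case/imsetP => i _ ->; rewrite cards2 xpair_eqE andbF. Qed.

Definition matching (t : nat) : sgraph := SGraph (@matching_edges_card2 t).

(* A copy of G in K_N is a subgraph (vertex set, edge set) of K_N isomorphic to
   G, so maps that differ by an automorphism of G give one and the same copy. *)
Definition copies (G : sgraph) (N : nat) :
    {set {set 'I_N} * {set {set 'I_N}}} :=
  [set (f @: [set: vertex G], [set f @: (e : {set vertex G}) | e in edges G])
     | f : {ffun vertex G -> 'I_N} & injectiveb f].

(* A k-coloring of the edges of K_N is a map c : {ffun {set 'I_N} -> 'I_k};
   everything below only reads its values on the 2-element sets. *)
Section Coloring.
Variables (N k : nat) (c : {ffun {set 'I_N} -> 'I_k}).

Definition exact_coloring : bool :=
  [forall j : 'I_k, exists e in edges (complete N), c e == j].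

Definition rainbow (S : {set 'I_N} * {set {set 'I_N}}) : bool :=
  [forall e in S.2, forall e' in S.2, (c e == c e') ==> (e == e')].

Definition monochromatic (S : {set 'I_N} * {set {set 'I_N}}) : bool :=
  [forall e in S.2, forall e' in S.2, c e == c e'].

Definition rainbow_copies (G : sgraph) := [set S in copies G N | rainbow S].

Definition mono_copies (H : sgraph) := [set S in copies H N | monochromatic S].

End Coloring.

Definition is_minimum (P : nat -> Prop) (m : nat) : Prop :=
  P m /\ forall n, P n -> m <= n.

Lemma is_minimum_unique (P : nat -> Prop) (m n : nat) :
  is_minimum P m -> is_minimum P n -> m = n.
Proof.
by case=> Pm mP [Pn nP]; apply/eqP; rewrite eqn_leq mP // nP.
Qed.

Definition is_gallai_ramsey (k : nat) (G H : sgraph) (m : nat) : Prop :=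
  is_minimum (fun m => k <= 'C(m, 2) /\
    forall N, m <= N -> forall c : {ffun {set 'I_N} -> 'I_k},
      exact_coloring c ->
      (exists S, S \in rainbow_copies c G) \/ (exists S, S \in mono_copies c H))
  m.

(* GM_k(G : H) = n, including the claim that gr_k(G : H) exists. *)
Definition is_gallai_ramsey_multiplicity (k : nat) (G H : sgraph) (n : nat) :
    Prop :=
  exists2 m, is_gallai_ramsey k G H m &
    is_minimum (fun n => exists2 c : {ffun {set 'I_m} -> 'I_k},
      exact_coloring c & n = #|rainbow_copies c G| + #|mono_copies c H|) n.

(* Main.v *)
(** The value of [gr_k] is [k + 3].

    A color class without monochromatic [2K_2] is an intersecting family of
    edges, hence a star or has at most three edges.  Suppose that a coloring of
    [K_N], [N >= k + 3], with [k] colors has at most two monochromatic [2K_2],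
    and delete one edge from each of them.  If [t] of the remaining classes are
    not stars, at least [t + 3] vertices are not the chosen centre of a star,
    and the edges between them, apart from the deleted ones, lie in the [t]
    small classes: [C(t + 3, 2) <= 3 t + 2], which is impossible.

    Conversely, color an edge of [K_N] by the minimum of [k - 1] and its least vertex,
    the vertices being numbered from [0].  There is no rainbow triangle, and a
    monochromatic [2K_2] lies in the last [N - k + 1] vertices; there are none
    for [N = k + 2] and three for [N = k + 3]. *)
Require Import Defs.
From mathcomp Require Import all_boot.
From mathcomp Require Import all_order.
From mathcomp Require Import zify.

Set Implicit Arguments.
Unset Strict Implicit.
Unset Printing Implicit Defensive.

(** * Intersecting families of edges *)

Lemma intersecting_pairs (T : finType) (F : {set {set T}}) :
    (forall e, e \in F -> #|e| = 2) ->
    (forall e e', e \in F -> e' \in F -> ~~ [disjoint e & e']) ->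
  (exists x, forall e, e \in F -> x \in e) \/ #|F| <= 3.
Proof.
move=> F2 Fint.
have [[x /forall_inP xF]|noc] :=
  altP (@existsP _ (fun x => [forall e in F, x \in e])).
  by left; exists x.
right; have avoid x : exists2 e, e \in F & x \notin e.
  by move/existsPn/(_ x): noc => /forall_inPn.
have meet e e' : e \in F -> e' \in F -> exists2 x, x \in e & x \in e'.
  by move=> eF e'F; have /pred0Pn[x /andP[]] := Fint _ _ eF e'F; exists x.
have pairE e x y : e \in F -> x != y -> x \in e -> y \in e -> e = [set x; y].
  move=> eF xy xe ye; apply/esym/eqP.
  by rewrite eqEcard subUset !sub1set xe ye F2 // cards2 xy.
have [->|[e0 e0F]] := set_0Vmem F; first by rewrite cards0.
have /eqP/cards2P[a [b [ab e0E]]] := F2 _ e0F; rewrite e0E in e0F.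
(* Some edge misses [a] and some edge misses [b]; both meet [[set a; b]], so they contain [b] and
   [a] respectively, and they meet each other in a third vertex [z], which closes a triangle. *)
have [e1 e1F ae1] := avoid a; have [e2 e2F be2] := avoid b.
have be1 : b \in e1.
  by have [x /set2P[]-> //] := meet _ _ e0F e1F; rewrite (negPf ae1).
have ae2 : a \in e2.
  by have [x /set2P[]-> //] := meet _ _ e0F e2F; rewrite (negPf be2).
have [z ze1 ze2] := meet _ _ e1F e2F.
have za : a != z by apply: contraNneq ae1 => ->.
have zb : b != z by apply: contraNneq be2 => ->.
have e1E := pairE _ _ _ e1F zb be1 ze1; have e2E := pairE _ _ _ e2F za ae2 ze2.
rewrite {}e1E in e1F ae1 {be1 ze1}; rewrite {}e2E in e2F be2 {ae2 ze2}.
(* An edge that meets all three sides of the triangle is itself a side. *)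
have sub : F \subset [:: [set a; b]; [set b; z]; [set a; z]].
  apply/subsetP => e eF; rewrite !inE.
  have [ae|ae] := boolP (a \in e).
    by have [x /set2P[]-> xe] := meet _ _ e1F eF;
      [rewrite (pairE e a b) // eqxx | rewrite (pairE e a z) // eqxx !orbT].
  have [x /set2P[]-> xe] := meet _ _ e0F eF; first by rewrite xe in ae.
  have [y /set2P[]-> ye] := meet _ _ e2F eF; first by rewrite ye in ae.
  by rewrite (pairE e b z) // eqxx orbT.
by apply: leq_trans (subset_leq_card sub) (card_size _).
Qed.

(** * Copies of [2K_2] as pairs of disjoint edges *)

Lemma copies_matching2P (N : nat) (S : {set 'I_N} * {set {set 'I_N}}) :
  reflect (exists e e' : {set 'I_N}, [/\ #|e| = 2, #|e'| = 2, [disjoint e & e']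
                          & S = (e :|: e', [set e; e'])])
          (S \in copies (matching 2) N).
Proof.
have copyE (f : {ffun 'I_2 * bool -> 'I_N}) :
    (f @: [set: vertex (matching 2)],
     [set f @: (e : {set vertex (matching 2)}) | e in edges (matching 2)])
    = ([set f (ord0, false); f (ord0, true)]
         :|: [set f (ord_max, false); f (ord_max, true)],
       [set [set f (ord0, false); f (ord0, true)];
            [set f (ord_max, false); f (ord_max, true)]]).
  have ord2 (i : 'I_2) : i = ord0 \/ i = ord_max.
    by case: i => [[|[|//]] lti]; [left|right]; apply: val_inj.
  have edgeE i : f @: [set (i, false); (i, true)] = [set f (i, false); f (i, true)].
    by rewrite imsetU1 imset_set1.
  congr pair; apply/setP => x.
    apply/imsetP/idP => [[[i b] _ ->]|].
      by case: (ord2 i) b => -> []; rewrite !inE eqxx ?orbT.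
    by rewrite !inE => /orP[] /orP[] /eqP->; eexists; rewrite ?inE.
  apply/imsetP/idP => [[e /imsetP[i _ ->] ->]|].
    by rewrite edgeE; case: (ord2 i) => ->; rewrite !inE eqxx ?orbT.
  by rewrite !inE => /orP[] /eqP->; rewrite -edgeE; eexists; rewrite //; apply: imset_f.
apply: (iffP imsetP) => [[f]|[e [e' [/eqP/cards2P[a [b [neq_ab ->]]]
    /eqP/cards2P[x [y [neq_xy ->]]] dis ->]]]].
  rewrite inE => /injectiveP finj ->; rewrite copyE.
  exists [set f (ord0, false); f (ord0, true)].
  exists [set f (ord_max, false); f (ord_max, true)].
  rewrite !cards2 !(inj_eq finj) /=; split=> //.
  by rewrite disjoints_subset subUset !sub1set !inE !(inj_eq finj).
(* The index reads [p] as a two-digit binary number, so it is below 4 and the default [a] is never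
   reached. *)
pose f := [ffun p : 'I_2 * bool => nth a [:: a; b; x; y] (p.1.*2 + p.2)].
exists f; last by rewrite copyE !ffunE.
rewrite inE; apply/injectiveP => -[i u] [j v]; rewrite !ffunE /=.
have us : uniq [:: a; b; x; y].
  move: dis; rewrite disjoints_subset subUset !sub1set !inE /= !inE !negb_or.
  by rewrite neq_ab neq_xy => /andP[/andP[-> ->] /andP[-> ->]].
have bound (l : 'I_2) (w : bool) : l.*2 + w < 4.
  by have := ltn_ord l; case: w; lia.
move/eqP; rewrite nth_uniq ?bound //= => /eqP eq_ij.
have eij : i = j by apply: val_inj => /=; move: eq_ij; case: u; case: v; lia.
by congr pair => //; move: eq_ij; rewrite eij => /addnI; case: u; case: v.
Qed.

Lemma mono_copies_matching2P (N k : nat) (c : {ffun {set 'I_N} -> 'I_k}) S :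
  reflect (exists e e' : {set 'I_N}, [/\ #|e| = 2, #|e'| = 2, [disjoint e & e'],
                                        c e = c e' & S = (e :|: e', [set e; e'])])
          (S \in mono_copies c (matching 2)).
Proof.
rewrite inE; apply: (iffP andP) => [[/copies_matching2P[e [e' [e2 e'2 dis ->]]]]|].
  move=> /forall_inP/(_ e (set21 _ _))/forall_inP/(_ e' (set22 _ _))/eqP ee'.
  by exists e, e'.
move=> [e [e' [e2 e'2 dis ee' ->]]]; split.
  by apply/copies_matching2P; exists e, e'.
by do 2!apply/forall_inP => ? /set2P[]->; rewrite ?ee'.
Qed.

(** * The lower bound *)

Lemma three_mono_matchings (N k : nat) (c : {ffun {set 'I_N} -> 'I_k}) :
  k + 3 <= N -> 3 <= #|mono_copies c (matching 2)|.
Proof.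
move=> leN; rewrite ltnNge; apply/negP => leM.
set M := mono_copies c (matching 2) in leM.
(* [mark] selects the edge to delete from a copy; the default [set0] does not arise on [M], where
   edge sets are nonempty. [R] is the set of deleted edges. *)
pose mark (S : {set 'I_N} * {set {set 'I_N}}) := odflt set0 [pick e in S.2].
pose R := [set mark S | S in M].
have leR : #|R| <= 2 by apply: leq_trans leM; apply: leq_imset_card.
pose F j := [set e : {set 'I_N} | [&& #|e| == 2, c e == j & e \notin R]].
(* Disjoint edges of [F j] would form a copy in [M], and its marked edge, one of the two, would lie
   in [R]. *)
have Fint j e e' : e \in F j -> e' \in F j -> ~~ [disjoint e & e'].
  rewrite !inE => /and3P[/eqP e2 /eqP ej eR] /and3P[/eqP e'2 /eqP e'j e'R].
  apply/negP => dis; set S := (e :|: e', [set e; e']).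
  have : S \in M.
    by apply/mono_copies_matching2P; exists e, e'; split; rewrite // e'j.
  move=> /(imset_f mark); rewrite -/R /mark /=.
  case: pickP => [e'' /set2P[]->|/(_ e)]; rewrite ?(negPf eR) ?(negPf e'R) //.
  by rewrite set21.
(* [ctr j] is the chosen centre of the class [F j], and an empty class counts as a star. [T] holds
   the colors without a centre, [X] the chosen centres. *)
pose ctr j := [pick x | [forall e in F j, x \in e]].
pose T := [set j | ~~ ctr j].
pose X := [set x | Some x \in [set ctr j | j in ~: T]].
have cardX : #|X| + #|T| <= k.
  rewrite -(card_imset _ Some_inj) -[leqRHS]card_ord -(cardsC T) addnC leq_add2l.
  apply: leq_trans (leq_imset_card ctr _).
  apply/subset_leq_card/subsetP => _ /imsetP[x + ->].
  by rewrite inE.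
pose P := [set e : {set 'I_N} | e \subset ~: X & #|e| == 2].
have cardP : #|P| <= #|T| * 3 + 2.
  (* An edge outside [R] whose color has a centre contains that centre, so it cannot avoid [X]. *)
  have sub : P \subset R :|: \bigcup_(j in T) F j.
    apply/subsetP => e; rewrite !inE => /andP[eX e2].
    case: (boolP (e \in R)) => //= eR; apply/bigcupP; exists (c e); last first.
      by rewrite inE e2 eqxx.
    rewrite inE; case cE: (ctr (c e)) => [x|] //.
    have : x \in e.
      move: cE; rewrite /ctr; case: pickP => // y /forall_inP yF [<-].
      by apply: yF; rewrite inE e2 eqxx.
    move=> /(subsetP eX); rewrite !inE => /negP[]; apply/imsetP.
    by exists (c e); rewrite ?inE cE.
  have leU (A B : {set {set 'I_N}}) : #|A :|: B| <= #|A| + #|B|.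
    exact: leq_card_setU.
  apply: leq_trans (subset_leq_card sub) _; apply: leq_trans (leU _ _) _.
  rewrite addnC leq_add // -sum_nat_const.
  elim/big_rec2: _ => [|j A m]; first by rewrite cards0.
  rewrite inE => jT leAm; apply: leq_trans (leU _ _) _; apply: leq_add leAm.
  move: jT; rewrite /ctr; case: pickP => //= noc _.
  have F2 e : e \in F j -> #|e| = 2 by rewrite inE => /andP[/eqP].
  have [[x xF]|//] := intersecting_pairs F2 (Fint j).
  by have /forall_inP[] := noc x.
have := cardP; rewrite cards_draws; have cX := cardsC X; rewrite card_ord in cX.
have /(leq_bin2l 2) : #|T| + 3 <= #|~: X| by lia.
(* With t = [#|T|], the bound C(t + 3, 2) <= 3 t + 2 amounts to t^2 + 2 <= t. *)
rewrite [X in X <= _]bin2; nia.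
Qed.

(** * The extremal coloring, with [k.+1] colors *)

Definition min_coloring (N k : nat) : {ffun {set 'I_N} -> 'I_k.+1} :=
  [ffun e : {set 'I_N} => inord (\big[Order.min/k]_(x in e) (x : nat))].

Section MinColoring.
Variables (N k : nat).
Implicit Types (e : {set 'I_N}) (x y : 'I_N).
Let c := min_coloring N k.

Lemma leq_min_coloring e t : (t <= c e) = (t <= k) && [forall x in e, t <= x].
Proof.
(* The minimum starts from [k], the last color, so it never exceeds [k] and [inord] preserves it. *)
rewrite ffunE inordK; last by rewrite ltnS; apply: (@Order.TotalTheory.bigmin_le_id _ nat).
apply/(@Order.TotalTheory.bigmin_geP _ nat)/andP => -[tk].
  by split=> //; apply/forall_inP.
by move/forall_inP.
Qed.

Lemma min_coloring2 x y : x <= y -> c [set x; y] = minn x k :> nat.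
Proof.
move=> xy; have le t : (t <= c [set x; y]) = (t <= minn x k).
  rewrite leq_min_coloring leq_min andbC; congr andb.
  apply/forall_inP/idP => [->|tx z /set2P[]->] //; first exact: set21.
  exact: leq_trans xy.
by apply/eqP; rewrite eqn_leq -le leqnn le leqnn.
Qed.

Lemma exact_min_coloring : k.+1 < N -> exact_coloring c.
Proof.
move=> ltkN; apply/forallP => j.
have lt1 : j.+1 < N by apply: leq_trans ltkN; rewrite ltnS.
(* Color [j] appears on the edge from [j] to [j + 1]; for [j = k] this takes [k.+1 < N]. *)
pose x := Ordinal (ltnW lt1); pose y := Ordinal lt1.
apply/exists_inP; exists [set x; y].
  by rewrite inE cards2 -val_eqE /= neq_ltn leqnn.
apply/eqP/val_inj; rewrite /= min_coloring2 //=.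
by apply/minn_idPl; rewrite -ltnS.
Qed.

(** The two edges of a triangle at its least vertex have the same color. *)
Lemma min_coloring_rainbow : rainbow_copies c (complete 3) = set0.
Proof.
apply/setP => S; rewrite !inE; apply/negP => /andP[/imsetP[f]].
rewrite inE => /injectiveP finj -> /= /forall_inP rb.
case: (@arg_minnP _ (ord0 : 'I_3) predT (fun i => f i : nat) isT) => i _ imin.
pose e (j : 'I_2) := [set i; lift i j].
have eS j : f @: e j \in
    [set f @: (e : {set vertex (complete 3)}) | e in edges (complete 3)].
  by apply: imset_f; rewrite inE cards2 neq_lift.
have fe j : f @: e j = [set f i; f (lift i j)] by rewrite imsetU1 imset_set1.
have /forall_inP/(_ _ (eS ord_max))/implyP := rb _ (eS ord0).
have -> : c (f @: e ord0) == c (f @: e ord_max).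
  by rewrite -val_eqE /= !fe !min_coloring2 // imin.
move=> /(_ isT)/eqP/(imset_inj finj)/setP/(_ (lift i ord0)).
by rewrite !inE eqxx orbT eq_sym (negPf (neq_lift _ _)) (inj_eq lift_inj).
Qed.

(** Edges of a common color below [k] share their least vertex, so disjoint edges of equal color
    have color [k]. *)
Lemma mono_min_coloring e e' : #|e| = 2 -> #|e'| = 2 -> [disjoint e & e'] ->
  c e = c e' -> e :|: e' \subset [set x : 'I_N | k <= x].
Proof.
have main (e1 e2 : {set 'I_N}) : #|e1| = 2 -> #|e2| = 2 ->
    [disjoint e1 & e2] -> c e1 = c e2 -> forall z : 'I_N, z \in e1 -> k <= z.
  have ordered (e0 : {set 'I_N}) : #|e0| = 2 ->
      exists x y : 'I_N, x < y /\ e0 = [set x; y].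
    move=> /eqP/cards2P[x [y [xy ->]]]; have [lt|lt|/val_inj eq] := ltngtP x y.
    - by exists x, y.
    - by exists y, x; rewrite setUC.
    - by rewrite eq eqxx in xy.
  move=> /ordered[x [y [xy ->]]] /ordered[u [v [uv ->]]] dis /(congr1 val) /=.
  rewrite !min_coloring2 1?ltnW // => cE z.
  have xu : x != u :> nat.
    apply: contraTneq dis => /val_inj ->.
    by rewrite disjoints_subset subUset !sub1set !inE eqxx.
  have kx : k <= x by move/eqP: xu => xu; lia.
  by move=> /set2P[]-> //; apply: ltnW; apply: leq_ltn_trans xy.
move=> e2 e'2 dis ee'; apply/subsetP => z; rewrite !inE => /orP[]; first exact: (main e e').
by apply: (main e' e); rewrite // disjoint_sym.
Qed.

Lemma card_ord_geq : #|[set x : 'I_N | k <= x]| = N - k.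
Proof.
rewrite -sum1_card -[RHS]muln1 -sum_nat_const_nat big_geq_mkord.
by apply: eq_bigl => x; rewrite inE.
Qed.

End MinColoring.

(** A monochromatic copy would need four vertices among the [N - k] that are at least [k]. *)
Lemma mono_min_coloring_set0 (N k : nat) : N < k + 4 ->
  mono_copies (min_coloring N k) (matching 2) = set0.
Proof.
move=> ltN; apply/eqP/set0Pn => -[S /mono_copies_matching2P[e [e' [e2 e'2 dis cE _]]]].
have := subset_leq_card (mono_min_coloring e2 e'2 dis cE).
by rewrite cardsU disjoint_setI0 // cards0 e2 e'2 card_ord_geq; lia.
Qed.

(** Exactly four vertices are at least [k], so a monochromatic copy is a perfect matching of them,
    determined by the partner [y] of the vertex [a]. *)
Lemma card_mono_min_coloring (N k : nat) : N = k + 4 ->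
  #|mono_copies (min_coloring N k) (matching 2)| <= 3.
Proof.
move=> eqN; have ltkN : k < N by lia.
pose a := Ordinal ltkN; pose W := [set x : 'I_N | k <= x].
have aW : a \in W by rewrite inE /=.
have cW : #|W| = 4 by rewrite card_ord_geq; lia.
have sub : mono_copies (min_coloring N k) (matching 2)
    \subset [set (W, [set [set a; y]; W :\: [set a; y]]) | y in W :\ a].
  have main (e e' : {set 'I_N}) : #|e| = 2 -> [disjoint e & e'] -> e :|: e' = W -> a \in e ->
      (e :|: e', [set e; e'])
        \in [set (W, [set [set a; y]; W :\: [set a; y]]) | y in W :\ a].
    move=> e2 dis eW ae.
    have /eqP/cards1P[y yE] : #|e :\ a| = 1.
      by move: (cardsD1 a e); rewrite ae e2 => -[->].
    have eE : e = [set a; y] by rewrite -(setD1K ae) yE.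
    apply/imsetP; exists y.
      have : y \in e :\ a by rewrite yE set11.
      by rewrite -eW !inE => /andP[-> ->].
    by rewrite -eE -eW setDUl setDv set0U (setDidPl _) // disjoint_sym.
  apply/subsetP => S /mono_copies_matching2P[e [e' [e2 e'2 dis cE ->]]].
  have eW : e :|: e' = W.
    apply/eqP; rewrite eqEcard mono_min_coloring // cW.
    by rewrite cardsU disjoint_setI0 // cards0 e2 e'2.
  have : a \in e :|: e' by rewrite eW.
  rewrite inE => /orP[]; first exact: main.
  by rewrite setUC [ [set e; e'] ]setUC; apply: main; rewrite // 1?disjoint_sym 1?setUC.
apply: leq_trans (subset_leq_card sub) _; apply: leq_trans (leq_imset_card _ _) _.
by move: (cardsD1 a W); rewrite aW cW => -[->].
Qed.

Theorem theorem3p9 (k : nat) (hk : 6 <= k) :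
  is_gallai_ramsey_multiplicity k (complete 3) (matching 2) 3.
Proof.
case: k hk => // k _; exists (k.+1 + 3); split.
- split=> [|N leN c _].
    by rewrite bin2; nia.
  by right; apply/set0Pn; rewrite -card_gt0; apply: leq_trans (three_mono_matchings c leN).
- move=> m [_ mP]; rewrite leqNgt; apply/negP => ltm.
  have lem : m <= k + 3 by lia.
  (* For [k.+1] colors, [k + 3] is one vertex short of the claimed value, and the coloring avoids
     both configurations there. *)
  have [] := mP _ lem (min_coloring (k + 3) k).
  + by apply: exact_min_coloring; lia.
  + by move=> [S]; rewrite min_coloring_rainbow inE.
  + by move=> [S]; rewrite mono_min_coloring_set0 ?inE //; lia.
- exists (min_coloring _ k); first by apply: exact_min_coloring; lia.
  rewrite min_coloring_rainbow cards0; apply/eqP.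
  by rewrite eqn_leq three_mono_matchings // card_mono_min_coloring //; lia.
- move=> n [c _ ->]; apply: leq_trans (three_mono_matchings c (leqnn _)) (leq_addl _ _).
Qed.
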